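(* Let $n\ge1$. The following (quasi)equations (each universally quantified over all element variables occurring in it) form a finite quasiequational axiomatisation of the class of $(\langle\ \rangle;,\mathsf A_1,\dots,\mathsf A_n)$-algebras that are representable by injective $n$-ary partial functions: (1) $\langle \boldsymbol a; b_1,\dots,\boldsymbol a; b_n\rangle ; c = \boldsymbol a;(\boldsymbol b; c)$; (2) $\boldsymbol\pi; a = a$; (3) $\langle \mathsf A_1^n a\rangle; a = 0$ (i.e. $\langle \mathsf A_1^n a\rangle; a=\langle \mathsf A_1^n b\rangle; b$ for all $a,b$, so that $0$ is a well-defined constant); (4) $\langle a_1,\dots,a_{i-1},0,a_{i+1},\dots,a_n\rangle; b = 0$ for every $i$; (5) $\boldsymbol a; 0 = 0$; (6) $\boldsymbol a;\mathsf A_i b = \langle \mathsf A_1^n(\boldsymbol a; b)\rangle;\langle \mathsf D_1^n a_1\rangle;\cdots;\langle \mathsf D_1^n a_n\rangle; a_i$ for every $i$; (7) $\langle \mathsf D_1^n a\rangle; b=\langle \mathsf D_1^n a\rangle; c \ \wedge\ \langle \mathsf A_1^n a\rangle; b=\langle \mathsf A_1^n a\rangle; c \ \rightarrow\ b=c$; (8) $\langle \mathsf D_1^n a\rangle; a = a$; (9) $\mathsf A_i\mathsf A_j a=\mathsf A_i\mathsf A_k a$ for every $i,j,k$; (10) $\boldsymbol b; a=\boldsymbol c; a\ \rightarrow\ \boldsymbol b;\mathsf D_i a=\boldsymbol c;\mathsf D_i a$ for every $i$.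
   Context: Fix $n\ge 1$; indices $i,j,k$ range over $\{1,\dots,n\}$. The signature has an $(n+1)$-ary operation (composition), written $\langle a_1,\dots,a_n\rangle ; b$, and unary operations $\mathsf A_1,\dots,\mathsf A_n$. Algebras are nonempty. An $n$-ary partial function on a set $X$ is a set $f\subseteq X^{n+1}$ such that $(\boldsymbol x,y),(\boldsymbol x,z)\in f$ implies $y=z$ (where $\boldsymbol x\in X^n$); it is injective if $(\boldsymbol x,z),(\boldsymbol y,z)\in f$ implies $\boldsymbol x=\boldsymbol y$. An algebra of $n$-ary partial functions of this signature is an algebra whose elements are $n$-ary partial functions, for which there are a set $X$ (the base) and an equivalence relation $E$ on $X$ such that every tuple $(x_1,\dots,x_{n+1})$ in every element lies in $X^{n+1}$ and has pairwise $E$-equivalent entries, and whose operations are $\boldsymbol f; g=\{(\boldsymbol x,z)\in X^{n+1} : \exists \boldsymbol y\in X^n,\ (\boldsymbol x,y_i)\in f_i \text{ for each } i \text{ and } (\boldsymbol y,z)\in g\}$, $\mathsf A_i(f)=\{(\boldsymbol x,x_i)\in X^{n+1} : x_1,\dots,x_n \text{ all } E\text{-equivalent and there is no } y\in X \text{ with } (\boldsymbol x,y)\in f\}$. An algebra is representable by injective $n$-ary partial functions if it is isomorphic to an algebra of $n$-ary partial functions of the same signature all of whose elements are injective. Notation: a bold symbol $\boldsymbol a$ in a term $\boldsymbol a; b$ stands for $\langle a_1,\dots,a_n\rangle$; unbracketed compositions associate to the right ($\boldsymbol a;\boldsymbol b; c=\boldsymbol a;(\boldsymbol b; c)$); for unary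 operations $\mathsf B_1,\dots,\mathsf B_n$, $\langle \mathsf B_1^n a\rangle$ means $\langle \mathsf B_1 a,\dots,\mathsf B_n a\rangle$. Abbreviations: $0:=\langle \mathsf A_1^n b\rangle; b$ for any $b$; $\pi_i:=\mathsf A_i 0$; $\boldsymbol\pi:=\langle\pi_1,\dots,\pi_n\rangle$; $\mathsf D_i a:=\mathsf A_i\mathsf A_i a$. *)

(* Defs.v *)
From Stdlib Require List.
From Stdlib Require Import RelationClasses.
From mathcomp Require Import all_boot.
From mathcomp Require Import boolp classical_sets.

Set Implicit Arguments.
Unset Strict Implicit.
Unset Printing Implicit Defensive.

Local Open Scope classical_set_scope.

(** * Abstract algebras of the signature *)

Record algebra (n : nat) := Algebra {
  carrier :> Type;
  alg_comp : n.-tuple carrier -> carrier -> carrier;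
  alg_anti : 'I_n -> carrier -> carrier;
  carrier_nonempty : inhabited carrier
}.

Definition isomorphic (n : nat) (A B : algebra n) : Prop :=
  exists h : A -> B,
    [/\ bijective h,
        forall (a : n.-tuple A) (b : A),
          h (alg_comp a b) = alg_comp [tuple h (tnth a i) | i < n] (h b)
      & forall (i : 'I_n) (a : A), h (alg_anti i a) = alg_anti i (h a)].

(** * Algebras of n-ary partial functions *)

(* A subset of X^(n+1), with X^(n+1) rendered as X^n * X. *)
Definition nary_rel (n : nat) (X : Type) := set (n.-tuple X * X).

Section PartialFunctions.
Variables (n : nat) (X : Type) (E : X -> X -> Prop).

Definition partial_function (f : nary_rel n X) : Prop :=
  forall x y z, f (x, y) -> f (x, z) -> y = z.

Definition injective_rel (f : nary_rel n X) : Prop :=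
  forall x y z, f (x, z) -> f (y, z) -> x = y.

Definition entries_equivalent (f : nary_rel n X) : Prop :=
  forall x y, f (x, y) ->
    (forall i j : 'I_n, E (tnth x i) (tnth x j)) /\
    (forall i : 'I_n, E (tnth x i) y).

Definition rel_comp (f : n.-tuple (nary_rel n X)) (g : nary_rel n X) :
    nary_rel n X :=
  [set xz | exists y : n.-tuple X,
     (forall i : 'I_n, tnth f i (xz.1, tnth y i)) /\ g (y, xz.2)].

Definition rel_anti (i : 'I_n) (f : nary_rel n X) : nary_rel n X :=
  [set xz | [/\ xz.2 = tnth xz.1 i,
                forall j k : 'I_n, E (tnth xz.1 j) (tnth xz.1 k)
              & ~ exists y, f (xz.1, y)]].

End PartialFunctions.

(* The base is allowed to be empty: the one-element algebra can only be
   represented over the empty base. *)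
Record pfun_algebra (n : nat) := PfunAlgebra {
  base : Type;
  base_eqv : base -> base -> Prop;
  base_eqvP : Equivalence base_eqv;
  elements : set (nary_rel n base);
  elements_nonempty : elements !=set0;
  elements_pfun : forall f, elements f -> partial_function f;
  elements_eqv : forall f, elements f -> entries_equivalent base_eqv f;
  elements_comp : forall (f : n.-tuple (nary_rel n base)) g,
    (forall i, elements (tnth f i)) -> elements g -> elements (rel_comp f g);
  elements_anti : forall i f, elements f -> elements (rel_anti base_eqv i f)
}.

Section AlgebraOfPfuns.
Variables (n : nat) (P : pfun_algebra n).

Definition element : Type := {f : nary_rel n (base P) | elements f}.

Fact element_comp_subproof (f : n.-tuple element) (g : element) :
  elements (rel_comp [tuple sval (tnth f i) | i < n] (sval g)).
Proof.
apply: elements_comp (svalP g) => i.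
by rewrite tnth_mktuple; apply: svalP.
Qed.

Definition element_comp (f : n.-tuple element) (g : element) : element :=
  exist _ _ (element_comp_subproof f g).

Definition element_anti (i : 'I_n) (f : element) : element :=
  exist _ _ (elements_anti i (svalP f)).

Fact element_nonempty : inhabited element.
Proof. by have [f Pf] := elements_nonempty P; exists; exists f. Qed.

Definition algebra_of_pfuns : algebra n :=
  Algebra element_comp element_anti element_nonempty.

End AlgebraOfPfuns.

Definition injectively_representable (n : nat) (A : algebra n) : Prop :=
  exists P : pfun_algebra n,
    (forall f, elements (p := P) f -> injective_rel f) /\
    isomorphic A (algebra_of_pfuns P).

(** * Terms and quasiequations *)

Inductive term (n : nat) (V : Type) : Type :=
| Var of V
| Comp of ('I_n -> term n V) & term n V
| Anti of 'I_n & term n V.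
Arguments Var {n V} _.

Fixpoint eval (n : nat) (V : Type) (A : algebra n) (v : V -> A)
    (t : term n V) : A :=
  match t with
  | Var x => v x
  | Comp s u => alg_comp [tuple eval v (s i) | i < n] (eval v u)
  | Anti i u => alg_anti i (eval v u)
  end.

Record equation (n : nat) (V : Type) :=
  Equation { lhs : term n V; rhs : term n V }.

(* An equation is a quasiequation without premises. *)
Record quasiequation (n : nat) (V : Type) :=
  Quasiequation { premises : seq (equation n V); conclusion : equation n V }.

Definition eq_true_at (n : nat) (V : Type) (A : algebra n) (v : V -> A)
    (e : equation n V) : Prop :=
  eval v (lhs e) = eval v (rhs e).

Definition satisfies (n : nat) (V : Type) (A : algebra n)
    (q : quasiequation n V) : Prop :=
  forall v : V -> A,
    List.Forall (eq_true_at v) (premises q) -> eq_true_at v (conclusion q).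

(** * The axioms *)

Inductive var (n : nat) : Type :=
| VecA of 'I_n | VecB of 'I_n | VecC of 'I_n
| VarA | VarB | VarC | VarZ.
Arguments VarA {n}.
Arguments VarB {n}.
Arguments VarC {n}.
Arguments VarZ {n}.

Declare Scope axiom_scope.
Notation "s ;; t" := (Comp s t)
  (at level 45, right associativity) : axiom_scope.
Notation "s ≈ t" := (Equation s t)
  (at level 50, no associativity) : axiom_scope.
Notation "p ⟹ e" := (Quasiequation p e)
  (at level 55, no associativity) : axiom_scope.

Section AxiomList.
Variable n : nat.
Local Open Scope axiom_scope.

Let tm := term n (var n).
Let vec := 'I_n -> tm.

Let a_ : vec := fun i => Var (VecA i).
Let b_ : vec := fun i => Var (VecB i).
Let c_ : vec := fun i => Var (VecC i).
Let a : tm := Var VarA.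
Let b : tm := Var VarB.
Let c : tm := Var VarC.
Let z : tm := Var VarZ.

Definition antis (t : tm) : vec := fun i => Anti i t.
Definition dom (i : 'I_n) (t : tm) : tm := Anti i (Anti i t).
Definition doms (t : tm) : vec := fun i => dom i t.

(* The constant 0 is the value of ⟨A_1 z, ..., A_n z⟩ ; z for an arbitrary z,
   so each axiom mentioning it is universally quantified over the reserved
   variable z as well. *)
Definition zero : tm := antis z ;; z.
Definition proj : vec := fun i => Anti i zero.

Definition assoc_ax := [::] ⟹ (fun i => a_ ;; b_ i) ;; c ≈ a_ ;; b_ ;; c.

Definition proj_ax := [::] ⟹ proj ;; a ≈ a.

Definition zero_ax := [::] ⟹ antis a ;; a ≈ zero.

Definition zero_arg_ax (i : 'I_n) :=
  [::] ⟹ (fun j => if j == i then zero else a_ j) ;; b ≈ zero.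

Definition comp_zero_ax := [::] ⟹ a_ ;; zero ≈ zero.

(* The fold is ⟨D a_1⟩ ; ... ; ⟨D a_n⟩ ; a_i, associated to the right. *)
Definition comp_anti_ax (i : 'I_n) :=
  [::] ⟹ a_ ;; Anti i b
       ≈ antis (a_ ;; b) ;;
         foldr (fun j t => doms (a_ j) ;; t) (a_ i) (enum 'I_n).

Definition cases_ax :=
  [:: doms a ;; b ≈ doms a ;; c; antis a ;; b ≈ antis a ;; c] ⟹ b ≈ c.

Definition dom_ax := [::] ⟹ doms a ;; a ≈ a.

Definition anti_anti_ax (i j k : 'I_n) :=
  [::] ⟹ Anti i (Anti j a) ≈ Anti i (Anti k a).

Definition injective_ax (i : 'I_n) :=
  [:: b_ ;; a ≈ c_ ;; a] ⟹ b_ ;; dom i a ≈ c_ ;; dom i a.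

Definition axioms : seq (quasiequation n (var n)) :=
  [:: assoc_ax; proj_ax; zero_ax]
  ++ [seq zero_arg_ax i | i <- enum 'I_n]
  ++ [:: comp_zero_ax]
  ++ [seq comp_anti_ax i | i <- enum 'I_n]
  ++ [:: cases_ax; dom_ax]
  ++ [seq q | i <- enum 'I_n,
              q <- [seq anti_anti_ax i j k | j <- enum 'I_n, k <- enum 'I_n]]
  ++ [seq injective_ax i | i <- enum 'I_n].

End AxiomList.

(* Main.v *)
Require Import Defs.
From Stdlib Require List.
From mathcomp Require Import all_boot.
From mathcomp Require Import boolp classical_sets.

(** Soundness is a computation with graphs of partial functions: composing
    with [<A_1 f, ..., A_n f>] restricts a function to the tuples outside the
    domain of [f], composing with [<D_1 f, ..., D_n f>] to the tuples inside
    it, and each law says something evident about such restrictions;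
    [law_inj] holds because injectivity of a function recovers the
    intermediate tuple of a composition from the value.

    Completeness is a Stone-type argument.  Write [off d x] and [on d x] for
    the two restrictions of [x], computed in the abstract algebra.  The
    equations, helped by [law_cases], which lets one reason by cases on a
    domain, force these operators to behave like multiplication by the
    elements of a Boolean algebra: they are idempotent and commute
    ([off_offC], [on_onC]), [on d] and [off d] annihilate each other
    ([on_off], [off_on]), a triple antidomain is a single one ([anti3]), and
    [on (on d e)] restricts to the intersection of two domains ([on_on]).

    An ultrafilter [U] of domains stands for a generic argument tuple; two
    elements are identified at [U] when they agree after restriction to some
    member of [U].  The resulting classes (germs) of the members of [U], which
    are exactly the germs different from that of zero ([sim_zeroP]), taken for
    all [U], are the points of the base; two points are equivalent when they
    come from the same [U].  An element [x] acts by sending the germs of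
    [a_1, ..., a_n] to the germ of [<a_1, ..., a_n> ; x] whenever the latter
    is not zero.

    - Composition is preserved by associativity, and antidomain by
      [law_comp_anti]: when [<a> ; x] is outside [U], all the restrictions on
      its right-hand side act trivially on germs ([comp_anti_sim]).
    - The action is injective because [law_inj] turns an agreement of
      [<a> ; x] with [<b> ; x] into one of [<a> ; D_i x] with [<b> ; D_i x],
      whose germs are those of [a_i] and [b_i] ([comp_sim_inj]).
    - Distinct elements act differently: by [law_cases] some ultrafilter
      avoids every domain on which the two agree ([ultra_separation]), and
      there the two elements do not send the germs of the projections to the
      same germ ([represent_faithful]). *)

Set Implicit Arguments.
Unset Strict Implicit.
Unset Printing Implicit Defensive.

(** * The axioms as laws on operations *)

Section Operations.
Variables (n : nat) (A : algebra n).
Implicit Types (a b c : 'I_n -> A) (d e f x y z : A).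

Definition comp a x : A := alg_comp [tuple a i | i < n] x.

Lemma alg_compE (a : n.-tuple A) x : alg_comp a x = comp (tnth a) x.
Proof.
by congr alg_comp; apply: eq_from_tnth => i; rewrite tnth_mktuple.
Qed.

(** [off d x] and [on d x] are the restrictions of [x] to the complement of the
    domain of [d] and to the domain of [d]. *)
Definition off d x : A := comp (fun i => alg_anti i d) x.

Definition on d x : A := comp (fun i => alg_anti i (alg_anti i d)) x.

Definition zero_of z : A := off z z.

(** The axioms freed from the syntax of terms, with vectors as functions on
    ['I_n], so that they can be used as rewriting rules. *)
Record laws : Prop := Laws {
  law_assoc : forall a b x,
    comp (fun i => comp a (b i)) x = comp a (comp b x);
  law_proj : forall z x, comp (fun i => alg_anti i (zero_of z)) x = x;
  law_zero : forall z x, zero_of x = zero_of z;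
  law_zero_arg : forall z i a x,
    comp (fun j => if j == i then zero_of z else a j) x = zero_of z;
  law_comp_zero : forall z a, comp a (zero_of z) = zero_of z;
  law_comp_anti : forall i a x,
    comp a (alg_anti i x) =
    off (comp a x) (foldr (fun j y => on (a j) y) (a i) (enum 'I_n));
  law_cases : forall d x y, on d x = on d y -> off d x = off d y -> x = y;
  law_on_id : forall x, on x x = x;
  law_anti_anti : forall i j k x,
    alg_anti i (alg_anti j x) = alg_anti i (alg_anti k x);
  law_inj : forall i a b x, comp a x = comp b x ->
    comp a (alg_anti i (alg_anti i x)) = comp b (alg_anti i (alg_anti i x))
}.

End Operations.

Lemma Forall_cat (T : Type) (P : T -> Prop) (s t : seq T) :
  List.Forall P (s ++ t) <-> List.Forall P s /\ List.Forall P t.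
Proof. exact: List.Forall_app. Qed.

Lemma Forall_map_mem (I : eqType) (T : Type) (P : T -> Prop) (F : I -> T)
    (s : seq I) :
  List.Forall P (map F s) <-> forall i, i \in s -> P (F i).
Proof.
elim: s => [|i s IH] /=; first by split.
split=> [/List.Forall_cons_iff [Pi /IH Ps] j|Ps].
  by rewrite inE => /orP [/eqP ->|/Ps].
apply/List.Forall_cons_iff; split; first by apply: Ps; rewrite inE eqxx.
by apply/IH => j js; apply: Ps; rewrite inE js orbT.
Qed.

Lemma Forall_map_enum (I : finType) (T : Type) (P : T -> Prop) (F : I -> T) :
  List.Forall P (map F (enum I)) <-> forall i, P (F i).
Proof.
rewrite Forall_map_mem; split=> PF i; last by move=> _; apply: PF.
by apply: PF; rewrite mem_enum.
Qed.

Lemma Forall_flatten_enum (I : finType) (T : Type) (P : T -> Prop)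
    (F : I -> seq T) :
  List.Forall P (flatten (map F (enum I))) <->
  forall i, List.Forall P (F i).
Proof.
have E s : List.Forall P (flatten (map F s)) <->
    List.Forall (List.Forall P) (map F s).
  elim: s => [|i s IH] /=; first by split=> _; apply: List.Forall_nil.
  by rewrite Forall_cat IH List.Forall_cons_iff.
by rewrite E Forall_map_enum.
Qed.

Section FromAxioms.
Variables (n : nat) (A : algebra n).

Definition valuation (a b c : 'I_n -> A) (x y w z : A) (t : var n) : A :=
  match t with
  | VecA i => a i | VecB i => b i | VecC i => c i
  | VarA => x | VarB => y | VarC => w | VarZ => z
  end.

Lemma satisfies_equation V (e : equation n V) :
  satisfies A (Quasiequation [::] e) <-> forall v : V -> A, eq_true_at v e.
Proof.
split=> H v; last by move=> _; apply: H.
by apply: H; apply: List.Forall_nil.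
Qed.

Lemma eval_fold_doms (v : var n -> A) i (s : seq 'I_n) :
  eval v (foldr (fun j t => Comp (doms (Var (VecA j))) t) (Var (VecA i)) s) =
  foldr (fun j y => on (v (VecA j)) y) (v (VecA i)) s.
Proof. by elim: s => //= j s ->. Qed.

Lemma axiomsP : List.Forall (satisfies A) (axioms n) <-> laws A.
Proof.
rewrite /axioms !Forall_cat !Forall_map_enum !Forall_flatten_enum.
rewrite !List.Forall_cons_iff !satisfies_equation.
split.
  move=> [[H1 [H2 [H3 _]]] [H4 [[H5 _] [H6 [[H7 [H8 _]] [H9 H10]]]]]].
  split.
  - by move=> a b x; apply: (H1 (valuation a b b x x x x)).
  - by move=> z x; apply: (H2 (valuation (fun=> x) (fun=> x) (fun=> x) x x x z)).
  - by move=> z x; apply: (H3 (valuation (fun=> x) (fun=> x) (fun=> x) x x x z)).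
  - move=> z i a x; have /satisfies_equation := H4 i.
    move=> /(_ (valuation a a a x x x z)); apply: etrans.
    by congr comp; apply/funext => j; case: ifP.
  - by move=> z a; apply: (H5 (valuation a a a z z z z)).
  - move=> i a x; have /satisfies_equation := H6 i.
    move=> /(_ (valuation a a a x x x x)) /=.
    by rewrite /eq_true_at /= eval_fold_doms.
  - move=> d x y e1 e2.
    by apply: (H7 (valuation (fun=> x) (fun=> x) (fun=> x) d x y x));
      do ?[apply: List.Forall_cons | apply: List.Forall_nil].
  - by move=> x; apply: (H8 (valuation (fun=> x) (fun=> x) (fun=> x) x x x x)).
  - move=> i j k x; have := H9 i; rewrite map_id Forall_flatten_enum => /(_ j).
    rewrite Forall_map_enum => /(_ k) /satisfies_equation.
    exact: (fun H => H (valuation (fun=> x) (fun=> x) (fun=> x) x x x x)).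
  - move=> i a b x e.
    by apply: (H10 i (valuation a a b x x x x));
      do ?[apply: List.Forall_cons | apply: List.Forall_nil].
move=> [H1 H2 H3 H4 H5 H6 H7 H8 H9 H10].
split; [split; [|split; [|split=> //]]|split; [|split; [split=> //|]]];
  last (split; [|split; [split; [|split=> //]|split]]).
- by move=> v; apply: H1.
- by move=> v; apply: H2.
- by move=> v; apply: H3.
- move=> i; apply/satisfies_equation => v.
  rewrite /eq_true_at /= -/(comp _ _).
  have -> : (fun j => eval v (if j == i then Defs.zero n else Var (VecA j))) =
            (fun j => if j == i then zero_of (v VarZ) else v (VecA j)).
    by apply/funext => j; case: ifP.
  exact: H4.
- by move=> v; apply: H5.
- move=> i; apply/satisfies_equation => v.
  by rewrite /eq_true_at /= eval_fold_doms; apply: H6.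
- move=> v /List.Forall_cons_iff [e1 /List.Forall_cons_iff [e2 _]].
  exact: H7 e1 e2.
- by move=> v; apply: H8.
- move=> i; rewrite map_id Forall_flatten_enum => j.
  rewrite Forall_map_enum => k.
  by apply/satisfies_equation => v; apply: H9.
- by move=> i v /List.Forall_cons_iff [e1 _]; apply: H10.
Qed.

End FromAxioms.

(** * Soundness *)

Section Embedding.
Variables (n : nat) (A B : algebra n) (h : A -> B).
Hypothesis h_inj : injective h.
Hypothesis h_comp : forall (a : n.-tuple A) b,
  h (alg_comp a b) = alg_comp [tuple h (tnth a i) | i < n] (h b).
Hypothesis h_anti : forall i a, h (alg_anti i a) = alg_anti i (h a).

Lemma eval_embedding V (v : V -> A) (t : term n V) :
  eval (h \o v) t = h (eval v t).
Proof.
elim: t => [x|s IHs u IHu|i u IHu] //=; last by rewrite h_anti IHu.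
rewrite h_comp IHu; congr alg_comp; apply: eq_from_tnth => i.
by rewrite !tnth_mktuple IHs.
Qed.

(** Premises as well as conclusions are reflected by an embedding, so even
    quasiequations pass from an algebra to the algebras embedded in it; hence
    soundness need only be proved for genuine algebras of functions. *)
Lemma satisfies_embedding V (q : quasiequation n V) :
  satisfies B q -> satisfies A q.
Proof.
have E v e : eq_true_at (h \o v) e <-> eq_true_at v e.
  by rewrite /eq_true_at !eval_embedding; split=> [/h_inj|->].
move=> Bq v prem; apply/E/Bq; apply: List.Forall_impl prem => e.
by move/E.
Qed.

End Embedding.

Section Soundness.
Variables (n : nat) (hn : 0 < n) (P : pfun_algebra n).
Hypothesis P_inj : forall f, elements (p := P) f -> injective_rel f.

Let i0 : 'I_n := Ordinal hn.
Let B := algebra_of_pfuns P.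
Let E := @base_eqv n P.
Implicit Types (f g : B) (a b c : 'I_n -> B).

Let graph f (x : n.-tuple (base P)) (y : base P) : Prop := sval f (x, y).

Let graph_ext f g : (forall x y, graph f x y <-> graph g x y) -> f = g.
Proof.
case: f g => [f Pf] [g Pg] fg; apply: eq_exist.
by apply/funext => -[x y]; apply/propext/fg.
Qed.

Let graph_fun f x y z : graph f x y -> graph f x z -> y = z.
Proof. exact: elements_pfun (svalP f) x y z. Qed.

Let graph_inj f x y z : graph f x z -> graph f y z -> x = y.
Proof. exact: P_inj (svalP f) x y z. Qed.

Let graph_eqv f x y : graph f x y -> forall i j, E (tnth x i) (tnth x j).
Proof. by move/(elements_eqv (svalP f)) => []. Qed.

Let graph_eqv_val f x y : graph f x y -> forall i, E (tnth x i) y.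
Proof. by move/(elements_eqv (svalP f)) => []. Qed.

Let graph_comp a g x z : graph (comp a g) x z <->
  exists2 y, (forall i, graph (a i) x (tnth y i)) & graph g y z.
Proof.
split=> [[y [ay gyz]]|[y ay gyz]]; exists y => //.
  by move=> i; have := ay i; rewrite !tnth_mktuple.
by split=> // i; rewrite !tnth_mktuple; apply: ay.
Qed.

Let graph_anti i f x z : graph (alg_anti i f) x z <->
  [/\ z = tnth x i, forall j k, E (tnth x j) (tnth x k)
    & ~ exists y, graph f x y].
Proof. by []. Qed.

Let graph_anti_anti i j f x z : graph (alg_anti i (alg_anti j f)) x z <->
  z = tnth x i /\ exists y, graph f x y.
Proof.
rewrite graph_anti; split=> [[-> Ex nf]|[-> [y fxy]]].
  split=> //; apply: contrapT => nfx; apply: nf; exists (tnth x j).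
  by rewrite graph_anti.
split=> //; first exact: graph_eqv fxy.
by case=> w; rewrite graph_anti => -[_ _]; apply; exists y.
Qed.

(* A tuple whose entries are related to [x] by the [A_i f] is [x] itself, since
   the [A_i f] are restrictions of the projections. *)
Let graph_off f g x z : graph (off f g) x z <->
  (~ exists y, graph f x y) /\ graph g x z.
Proof.
rewrite graph_comp; split=> [[y fxy gyz]|[nfx gxz]]; last first.
  exists x => // i; rewrite graph_anti; split=> //.
  exact: graph_eqv gxz.
have yx : y = x by apply: eq_from_tnth => i; have [] := fxy i.
by rewrite -{2}yx; split=> //; have [] := fxy i0.
Qed.

Let graph_on f g x z : graph (on f g) x z <->
  (exists y, graph f x y) /\ graph g x z.
Proof.
rewrite graph_comp; split=> [[y fxy gyz]|[fx gxz]]; last first.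
  by exists x => // i; rewrite graph_anti_anti.
have {}fxy i := (graph_anti_anti _ _ _ _ _).1 (fxy i).
have yx : y = x by apply: eq_from_tnth => i; have [] := fxy i.
by rewrite -{2}yx; split=> //; have [] := fxy i0.
Qed.

Let graph_zero f x z : ~ graph (zero_of f) x z.
Proof. by rewrite graph_off => -[nfx fxz]; apply: nfx; exists z. Qed.

Let graph_fold a g (s : seq 'I_n) x z :
  graph (foldr (fun j f => on (a j) f) g s) x z <->
  (forall j, j \in s -> exists y, graph (a j) x y) /\ graph g x z.
Proof.
elim: s => [|j s IH]; first by split=> [gxz|[]].
split=> [/graph_on [aj /IH [as_ gxz]]|[as_ gxz]].
  by split=> // k; rewrite inE => /orP [/eqP ->|/as_].
apply/graph_on; split; first by apply: as_; rewrite inE eqxx.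
by apply/IH; split=> // k ks; apply: as_; rewrite inE ks orbT.
Qed.

(** Two facts are used beyond the description of restrictions: the intermediate tuple of a composition is
    unique because functions are single-valued, which gives associativity and
    [law_comp_anti]; and by injectivity it is determined by the value, which
    gives [law_inj]. *)
Lemma pfun_laws : laws B.
Proof.
split.
- move=> a b f; apply: graph_ext => x z; rewrite !graph_comp.
  split=> [[y aby fyz]|[w aw]]; last first.
    rewrite graph_comp => -[y bwy fyz]; exists y => // i.
    by rewrite graph_comp; exists w.
  have {}aby i := (graph_comp _ _ _ _).1 (aby i).
  have [w aw _] := aby i0.
  exists w => //; rewrite graph_comp; exists y => // i.
  have [w' aw' bw'] := aby i; suff -> : w = w' by [].
  by apply: eq_from_tnth => j; apply: graph_fun (aw j) (aw' j).
- move=> f g; apply: graph_ext => x z; rewrite -/(off _ _) graph_off.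
  by split=> [[]//|gxz]; split=> // -[y /graph_zero].
- by move=> f g; apply: graph_ext => x z; split=> /graph_zero.
- move=> f i a g; apply: graph_ext => x z.
  split=> [|/graph_zero //]; rewrite graph_comp => -[y /(_ i)].
  by rewrite eqxx => /graph_zero.
- move=> f a; apply: graph_ext => x z.
  by split=> [|/graph_zero //]; rewrite graph_comp => -[y _ /graph_zero].
- move=> i a f; apply: graph_ext => x z; rewrite graph_off graph_fold.
  rewrite graph_comp; split=> [[y ay]|[nfx [ax aiz]]].
    rewrite graph_anti => -[-> Ey nfy]; split; last first.
      by split=> [j _|]; [exists (tnth y j); apply: ay | apply: ay].
    move=> [w]; rewrite graph_comp => -[y' ay' fy'w]; apply: nfy.
    exists w; suff -> : y = y' by [].
    by apply: eq_from_tnth => j; apply: graph_fun (ay j) (ay' j).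
  have /choice [y ay] : forall j, exists y, graph (a j) x y.
    by move=> j; apply: ax; rewrite mem_enum.
  have ay' j : graph (a j) x (tnth [tuple y k | k < n] j).
    by rewrite tnth_mktuple.
  exists [tuple y k | k < n] => //; rewrite graph_anti; split.
  + exact: graph_fun aiz (ay' i).
  + have [_ symE transE] := base_eqvP P.
    move=> j k; apply: transE (graph_eqv_val (ay' k) i0).
    exact/symE/(graph_eqv_val (ay' j) i0).
  + by move=> [w fw]; apply: nfx; exists w; rewrite graph_comp; eexists; eauto.
- move=> f g h eon eoff; apply: graph_ext => x z.
  have [fx|nfx] := pselect (exists y, graph f x y).
    have := graph_on f g x z; rewrite eon graph_on.
    by move=> [H1 H2]; split=> ?; [case: H2|case: H1].
  have := graph_off f g x z; rewrite eoff graph_off.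
  by move=> [H1 H2]; split=> ?; [case: H2|case: H1].
- move=> f; apply: graph_ext => x z; rewrite graph_on.
  by split=> [[]//|fxz]; split=> //; exists z.
- by move=> i j k f; apply: graph_ext => x z; rewrite !graph_anti_anti.
- have sub i a b f : comp a f = comp b f -> forall x z,
      graph (comp a (alg_anti i (alg_anti i f))) x z ->
      graph (comp b (alg_anti i (alg_anti i f))) x z.
    move=> eab x z; rewrite !graph_comp => -[y ay /[dup] fyz].
    rewrite graph_anti_anti => -[_ [w fyw]].
    have : graph (comp a f) x w by rewrite graph_comp; exists y.
    rewrite eab graph_comp => -[y' by' /graph_inj /(_ fyw) y'y].
    by exists y' => //; rewrite y'y.
  move=> i a b f eab; apply: graph_ext => x z.
  by split; apply: sub.
Qed.

End Soundness.

(** * The Boolean calculus of domains *)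

Section Completeness.
Local Open Scope classical_set_scope.
Variables (n : nat) (hn : 0 < n) (A : algebra n) (L : laws A) (o : A).

Let i0 : 'I_n := Ordinal hn.
Let zero : A := zero_of o.
Implicit Types (a b c : 'I_n -> A) (d e f x y z : A).

Lemma comp_zero_arg i a x : a i = zero -> comp a x = zero.
Proof.
move=> ai; rewrite -[RHS](law_zero_arg L o i a x) -/zero; congr comp.
by apply/funext => j; case: eqP => [->|].
Qed.

Lemma comp_zero a : comp a zero = zero.
Proof. exact: law_comp_zero. Qed.

Lemma off_self d : off d d = zero.
Proof. exact: law_zero. Qed.

Lemma off_zero_l x : off zero x = x.
Proof. exact: law_proj. Qed.

Lemma off_comp d a x : off d (comp a x) = comp (fun i => off d (a i)) x.
Proof. by rewrite /off (law_assoc L). Qed.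

Lemma on_comp d a x : on d (comp a x) = comp (fun i => on d (a i)) x.
Proof. by rewrite /on (law_assoc L). Qed.

Lemma on_off_anti j d x : on d x = off (alg_anti j d) x.
Proof. by congr comp; apply/funext => i; apply: law_anti_anti. Qed.

(** This is [law_comp_anti] for [a_j = A_j d]: every further factor is then the
    restriction to the domain of some [A_j d], under which [A_i d] is stable. *)
Lemma off_anti d i x : off d (alg_anti i x) = off (off d x) (alg_anti i d).
Proof.
rewrite /off (law_comp_anti L) -/(off _ _) -/(off _ _); congr off.
elim: (enum 'I_n) => //= j s ->; rewrite (on_off_anti i).
by rewrite (law_anti_anti L i j i) -(on_off_anti i) law_on_id.
Qed.

Lemma off_off d e x : off d (off e x) = off (off d e) (off d x).
Proof.
rewrite [off e x]/off off_comp [off d x]/off off_comp; congr comp.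
by apply/funext => i; apply: off_anti.
Qed.

Lemma off_anti_self d i : off d (alg_anti i d) = alg_anti i d.
Proof. by rewrite off_anti off_self off_zero_l. Qed.

Lemma off_idem d x : off d (off d x) = off d x.
Proof. by rewrite off_off off_self off_zero_l. Qed.

Lemma on_zero_l x : on zero x = zero.
Proof.
apply: (comp_zero_arg (i := i0)).
by rewrite -[LHS]off_zero_l off_anti off_zero_l off_self.
Qed.

Lemma off_zero_r d : off d zero = zero.
Proof. exact: comp_zero. Qed.

Lemma on_zero_r d : on d zero = zero.
Proof. exact: comp_zero. Qed.

Lemma on_anti_self d i : on d (alg_anti i d) = zero.
Proof. by rewrite (on_off_anti i) off_self. Qed.

(** The operator [on d] is [off (A_j d)], so [off_anti] gives
    [on d (A_i d) = off (on d d) (A_i (A_j d)) = off d (A_i (A_j d))], whose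
    first member is zero. *)
Lemma off_anti_anti d i j : off d (alg_anti i (alg_anti j d)) = zero.
Proof.
rewrite -(on_anti_self d i) [RHS](on_off_anti j) [RHS]off_anti -on_off_anti.
by rewrite law_on_id.
Qed.

Lemma on_off d x : on d (off d x) = zero.
Proof.
by rewrite [off d x]/off on_comp (comp_zero_arg (i := i0)) ?on_anti_self.
Qed.

Lemma off_on d x : off d (on d x) = zero.
Proof.
by rewrite [on d x]/on off_comp (comp_zero_arg (i := i0)) ?off_anti_anti.
Qed.

(** By cases on the domain of [d]: both sides vanish on it, and off it both are
    [A_i d]. *)
Lemma anti3 d i j k :
  alg_anti i (alg_anti j (alg_anti k d)) = alg_anti i d.
Proof.
apply: (law_cases L) (d) _ _ _ _; last first.
  by rewrite off_anti off_anti_anti off_zero_l off_anti_self.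
rewrite on_anti_self (on_off_anti j) (law_anti_anti L j k j).
by rewrite off_anti off_anti_self -on_off_anti on_anti_self.
Qed.

Lemma on_anti i d x : on (alg_anti i d) x = off d x.
Proof. by congr comp; apply/funext => j; apply: anti3. Qed.

Lemma on_off_off d e x : on d (off e x) = off (on d e) (on d x).
Proof. by rewrite !(on_off_anti i0) off_off. Qed.

(** It is enough to compare [off d (A_i e)] with [off e (A_i d)], by cases on
    the domain of [e]: on it both vanish, and off it both reduce to
    [off (off e d) (A_i e)]. *)
Lemma off_offC d e x : off d (off e x) = off e (off d x).
Proof.
rewrite [off e x in LHS]/off [off d x in RHS]/off !off_comp; congr comp.
apply/funext => i; apply: (law_cases L) (e) _ _ _ _; last first.
  by rewrite off_idem off_off off_anti_self -off_anti.
by rewrite on_off on_off_off on_anti_self off_zero_r.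
Qed.

Lemma on_offC d e x : on d (off e x) = off e (on d x).
Proof. by rewrite !(on_off_anti i0) off_offC. Qed.

Lemma on_onC d e x : on d (on e x) = on e (on d x).
Proof. by rewrite !(on_off_anti i0) off_offC. Qed.

Lemma on_idem d x : on d (on d x) = on d x.
Proof. by rewrite !(on_off_anti i0) off_idem. Qed.

(** The hypothesis says that the domain of [e] is contained in that of [d]. *)
Lemma on_absorb d e x : off d e = zero -> on d (on e x) = on e x.
Proof.
move=> de; rewrite [on e x]/on on_comp; congr comp; apply/funext => i.
apply: (law_cases L) (d) _ _ _ _; first exact: on_idem.
rewrite off_on off_anti [off d (alg_anti i e)]off_anti de off_zero_l.
by rewrite -on_off_anti on_anti_self.
Qed.

(** By cases on the domain of [on d e]: off it both sides vanish; on it the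
    restrictions to [d] and to [e] are absorbed, because that domain is
    contained in both. *)
Lemma on_on d e x : on (on d e) x = on d (on e x).
Proof.
apply: (law_cases L) (on d e) _ _ _ _.
  rewrite on_idem [RHS]on_onC [X in _ = on d X]on_onC.
  rewrite (on_absorb (d := e)) ?(on_absorb (d := d)) ?off_on //.
  by rewrite -on_offC off_self on_zero_r.
by rewrite off_on -on_off_off off_on on_zero_r.
Qed.

(** * Ultrafilters of domains *)

(** Domains are represented by the elements having them, so that no Boolean
    algebra need be built. *)
Record ultra (U : set A) : Prop := Ultra {
  ultra_zero : ~ U zero;
  ultra_on : forall d e, U d -> U e -> U (on d e);
  ultra_or : forall d i, U d \/ U (alg_anti i d)
}.

Definition sim (U : set A) x y : Prop := exists2 d, U d & on d x = on d y.

(** Filters that meet no domain on which [x] and [y] agree.  The condition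
    [on d (on e z) = on d z] for all [z] says that the domain of [d] is
    contained in that of [e].  The empty set must qualify, being the union of the
    empty chain in Zorn's lemma. *)
Definition separating x y (F : set A) : Prop :=
  [/\ forall d e, F d -> F e -> F (on d e),
      forall d e, F d -> (forall z, on d (on e z) = on d z) -> F e
    & forall d, F d -> on d x <> on d y].

(** The filter generated by [F] and [d], for nonempty [F]. *)
Definition adjoin (F : set A) d : set A :=
  [set e | exists2 f, F f &
     forall z, on f (on d (on e z)) = on f (on d z)].

Lemma adjoin_separating x y F d : separating x y F ->
  (forall f, F f -> on f (on d x) <> on f (on d y)) ->
  separating x y (adjoin F d).
Proof.
move=> [Fon Fup Fxy] Fdxy; split.
- move=> e e' [f Ff fe] [f' Ff' fe']; exists (on f f') => [|z].
    exact: Fon.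
  by rewrite !on_on (on_onC f f') fe (on_onC f' f) fe'.
- move=> e e' [f Ff fe] ee'; exists f => // z.
  by rewrite -fe ee' fe.
- by move=> e [f Ff fe] exy; apply: (Fdxy f Ff); rewrite -fe exy fe.
Qed.

(** A maximal separating filter is an ultrafilter: if neither [d] nor [A_i d]
    could be adjoined, then [x] and [y] would agree on a member restricted to
    the domain of [d] and on a member restricted to its complement, hence by
    [law_cases] on the intersection of these two members. *)
Lemma ultra_separation x y : x <> y -> exists2 U, ultra U & ~ sim U x y.
Proof.
move=> xy.
have [F Fch Ftot|U [[Uon Uup Uxy] Umax]] := @Zorn_bigcup A (separating x y).
  split.
  - move=> d e [F1 FF1 F1d] [F2 FF2 F2e].
    have [F12|F21] := Ftot _ _ FF1 FF2.
      exists F2 => //; have [Fon _ _] := Fch _ FF2; exact: Fon (F12 _ F1d) F2e.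
    exists F1 => //; have [Fon _ _] := Fch _ FF1; exact: Fon F1d (F21 _ F2e).
  - move=> d e [F1 FF1 F1d] de; exists F1 => //.
    by have [_ Fup _] := Fch _ FF1; apply: Fup F1d de.
  - by move=> d [F1 FF1 F1d]; have [_ _ F1xy] := Fch _ FF1; exact: F1xy.
have Umax' V : separating x y V -> U `<=` V -> V `<=` U.
  move=> Vsep UV; apply: contrapT => nVU; apply: Umax Vsep.
  exact: conj UV nVU.
have [f0 Uf0] : exists f, U f.
  apply: contrapT => U0; apply: (U0).
  (* The total elements form a separating filter above the empty one. *)
  pose one := [set d | forall z, on d z = z].
  have one_zero : one (alg_anti i0 zero).
    by move=> z; rewrite on_anti off_zero_l.
  exists (alg_anti i0 zero); apply: (Umax' one) one_zero.
    split=> [d e d1 e1 z|d e d1 de z|d d1].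
    - by rewrite on_on d1 e1.
    - by rewrite -[LHS]d1 de d1.
    - by rewrite !d1.
  by move=> f Uf; case: U0; exists f.
have dich d : (exists2 f, U f & on f (on d x) = on f (on d y)) \/ U d.
  have [|nf] := pselect (exists2 f, U f & on f (on d x) = on f (on d y)).
    by left.
  right; have dsep : separating x y (adjoin U d).
    by apply: adjoin_separating => // f Uf fd; apply: nf; exists f.
  apply: (Umax' _ dsep) => [f Uf|]; last first.
    by exists f0 => // z; rewrite on_idem.
  by exists f => // z; rewrite (on_onC d) on_idem.
exists U; last by move=> [d /Uxy].
split=> // [U0|d i]; first by apply: (Uxy _ U0); rewrite !on_zero_l.
have [[f Uf fd]|] := dich d; last by left.
have [[g Ug gd]|] := dich (alg_anti i d); last by right.
exfalso; apply: (Uxy (on f g) (Uon _ _ Uf Ug)).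
rewrite !on_anti in gd; rewrite !on_on; apply: (law_cases L) (d) _ _ _ _.
  by rewrite !(on_onC d) !(on_onC _ g) fd.
by rewrite -!on_offC gd.
Qed.

(** * The representation *)

Section Germs.
Variables (U : set A) (Uu : ultra U).

Lemma ultra_nonempty : exists d, U d.
Proof. by have [|] := ultra_or Uu o i0; [exists o | exists (alg_anti i0 o)]. Qed.

Lemma sim_refl x : sim U x x.
Proof. by have [d Ud] := ultra_nonempty; exists d. Qed.

Lemma sim_sym x y : sim U x y -> sim U y x.
Proof. by case=> d Ud e; exists d. Qed.

Lemma sim_trans y x z : sim U x y -> sim U y z -> sim U x z.
Proof.
move=> [d Ud xy] [e Ue yz]; exists (on d e); first exact: ultra_on.
by rewrite !on_on (on_onC d) xy (on_onC e) yz.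
Qed.

(** There are finitely many arguments, so one member of [U] witnesses all the
    agreements at once. *)
Lemma sim_comp a b x : (forall i, sim U (a i) (b i)) ->
  sim U (comp a x) (comp b x).
Proof.
move=> ab.
suff [d Ud dab] : exists2 d, U d & forall i, on d (a i) = on d (b i).
  by exists d => //; rewrite !on_comp; congr comp; apply/funext.
have [d Ud dab] : exists2 d, U d &
    forall i, i \in enum 'I_n -> on d (a i) = on d (b i).
  elim: (enum 'I_n) => [|i s [d Ud dab]].
    by have [d Ud] := ultra_nonempty; exists d.
  have [e Ue eab] := ab i; exists (on e d); first exact: ultra_on.
  move=> j; rewrite inE !on_on => /orP [/eqP ->|/dab ->] //.
  by rewrite !(on_onC e) eab.
by exists d => // i; apply: dab; rewrite mem_enum.
Qed.

Lemma sim_off d x : ~ U d -> sim U (off d x) x.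
Proof.
have [//|Ud] := ultra_or Uu d i0 => _.
by exists (alg_anti i0 d) => //; rewrite !on_anti off_idem.
Qed.

Lemma sim_on d x : U d -> sim U (on d x) x.
Proof. by exists d => //; rewrite on_idem. Qed.

(** If [d] is in [U] and [x] vanishes on [d], then [x] in [U] would put
    [on d x], which is zero, in [U]. *)
Lemma sim_zeroP x : sim U x zero <-> ~ U x.
Proof.
split=> [[d Ud dx] Ux|nUx].
  apply: (ultra_zero Uu); rewrite -(on_zero_r d) -dx.
  exact: ultra_on.
by apply: sim_sym; rewrite -(off_self x); apply: sim_off.
Qed.

Lemma sim_in x y : sim U x y -> U x -> U y.
Proof.
move=> xy; apply: contraPP => /sim_zeroP y0; apply/sim_zeroP.
exact: sim_trans xy y0.
Qed.

Lemma comp_in_arg a x i : U (comp a x) -> U (a i).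
Proof.
apply: contraPP => /sim_zeroP [d Ud ai]; apply/sim_zeroP; exists d => //.
by rewrite on_zero_r on_comp (comp_zero_arg (i := i)) // ai on_zero_r.
Qed.

Lemma comp_anti_notin a x i : U (comp a (alg_anti i x)) -> ~ U (comp a x).
Proof.
apply: contraPnot => Uax; apply/sim_zeroP; exists (comp a x) => //.
by rewrite (law_comp_anti L) on_off on_zero_r.
Qed.

(** In [law_comp_anti] the restriction to the complement of [<a> ; x] and those
    to the domains of the [a_j] are all invisible at [U]. *)
Lemma comp_anti_sim a x i : (forall j, U (a j)) -> ~ U (comp a x) ->
  sim U (comp a (alg_anti i x)) (a i).
Proof.
move=> Ua nUax; rewrite (law_comp_anti L).
apply: sim_trans (sim_off _ nUax) _.
elim: (enum 'I_n) => [|j s IH] /=; first exact: sim_refl.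
by apply: sim_trans IH; apply: sim_on.
Qed.

Lemma comp_dom_sim a x i : U (comp a x) ->
  sim U (comp a (alg_anti i (alg_anti i x))) (a i).
Proof.
move=> Uax; apply: comp_anti_sim => [j|/comp_anti_notin //].
exact: comp_in_arg Uax.
Qed.

(** [law_inj] is applied to the arguments restricted to a member of [U] on which
    the two composites agree. *)
Lemma comp_sim_inj a b x i : U (comp a x) -> sim U (comp a x) (comp b x) ->
  sim U (a i) (b i).
Proof.
move=> Uax abx; have Ubx := sim_in abx Uax; case: abx => d Ud.
rewrite !on_comp => /(law_inj L i); rewrite -!on_comp => abDx.
apply: sim_trans (comp_dom_sim i Ubx).
by apply: sim_trans (sim_sym (comp_dom_sim i Uax)) _; exists d.
Qed.

End Germs.

Definition germ (U : set A) x : set A := [set y | sim U x y].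

(** A point carries its ultrafilter, which makes the points over different
    ultrafilters disjoint; germs are encoded as equivalence classes. *)
Definition is_point (p : set A * set A) : Prop :=
  exists x, [/\ ultra p.1, p.1 x & p.2 = germ p.1 x].

Definition point : Type := {p | is_point p}.

(** [x] is a representative of the point [p], which lies over [U]. *)
Definition names (p : point) (U : set A) x : Prop := sval p = (U, germ U x).

Definition same_ultra (p q : point) : Prop := (sval p).1 = (sval q).1.

Lemma same_ultraP : RelationClasses.Equivalence same_ultra.
Proof.
split=> [p|p q|p q r]; rewrite /same_ultra //.
by move=> -> ->.
Qed.

Lemma names_same p q U x y : names p U x -> names q U y -> same_ultra p q.
Proof. by rewrite /same_ultra => -> ->. Qed.

Lemma names_ultra p q U V x y :
  names p U x -> names q V y -> same_ultra p q -> U = V.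
Proof. by rewrite /same_ultra => -> ->. Qed.

Lemma germ_eq U x y : ultra U -> germ U x = germ U y <-> sim U x y.
Proof.
move=> Uu; split=> [xy|xy].
  suff: germ U x y by [].
  by rewrite xy; apply: sim_refl.
apply/funext => z; apply/propext; split; last exact: sim_trans.
exact/sim_trans/sim_sym.
Qed.

Lemma ex_names p : exists U x, ultra U /\ names p U x.
Proof.
by case: p => -[U g] /= [x [/= Uu Ux gx]]; exists U, x; rewrite /names /= gx.
Qed.

Lemma ex_point U x : ultra U -> U x -> exists p, names p U x.
Proof.
move=> Uu Ux.
have Up : is_point (U, germ U x) by exists x.
by exists (exist _ _ Up).
Qed.

Lemma namesP p U x : names p U x -> ultra U /\ U x.
Proof.
case: p => -[V g] Vp; rewrite /names /= => -[VU gx].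
case: Vp => y /= [Vu Vy gy]; rewrite -VU; split=> //.
apply: sim_in Vy => //; apply/germ_eq => //.
by rewrite -gy gx VU.
Qed.

Lemma names_eq p q U x y : names p U x -> names q U y ->
  p = q <-> sim U x y.
Proof.
move=> px qy; have [Uu _] := namesP px; rewrite -germ_eq //.
split=> [pq|xy]; first by move: px; rewrite pq /names qy => -[].
case: p q px qy => [p Pp] [q Qq]; rewrite /names /= => px qy.
by apply: eq_exist; rewrite px qy xy.
Qed.

Lemma names_sim p U x y : names p U x -> sim U x y -> names p U y.
Proof.
move=> px xy; have [Uu _] := namesP px.
by rewrite /names px; congr pair; apply/germ_eq.
Qed.

(** The demand that the germ of [<a> ; x] be nonzero is carried by the type of
    the value, since only members of [U] name points. *)
Definition represent x : nary_rel n point :=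
  [set pq | exists U a, (forall i, names (tnth pq.1 i) U (a i)) /\
     names pq.2 U (comp a x)].

(** The values do not depend on the representatives chosen for the arguments. *)
Lemma representE (p : n.-tuple point) q U a x :
  (forall i, names (tnth p i) U (a i)) ->
  represent x (p, q) <-> names q U (comp a x).
Proof.
move=> pa; split=> [[V [b [/= pb qbx]]]|]; last by exists U, a.
have VU : V = U by apply: names_ultra (pb i0) (pa i0) _.
rewrite VU in pb qbx; have [Uu _] := namesP qbx.
apply: names_sim qbx _; apply: sim_comp => // i.
by apply/(names_eq (pb i) (pa i)).
Qed.

Lemma ex_names_tuple (p : n.-tuple point) :
  (forall i j, same_ultra (tnth p i) (tnth p j)) ->
  exists U a, forall i, names (tnth p i) U (a i).
Proof.
move=> pE; have [U [x [_ px]]] := ex_names (tnth p i0).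
have /choice [a pa] : forall i, exists y, names (tnth p i) U y.
  move=> i; have [V [y [_ py]]] := ex_names (tnth p i).
  by exists y; rewrite (names_ultra px py (pE _ _)).
by exists U, a.
Qed.

Lemma ex_point_tuple U a : ultra U -> (forall i, U (a i)) ->
  exists p : n.-tuple point, forall i, names (tnth p i) U (a i).
Proof.
move=> Uu Ua.
have /choice [p pa] : forall i, exists p, names p U (a i).
  by move=> i; apply: ex_point.
by exists [tuple p i | i < n] => i; rewrite tnth_mktuple.
Qed.

Lemma represent_fun x : partial_function (represent x).
Proof.
move=> p q r [U [a [/= pa qax]]] /(representE _ _ pa) rax.
apply/(names_eq qax rax); have [Uu _] := namesP qax; exact: sim_refl.
Qed.

Lemma represent_inj x : injective_rel (represent x).
Proof.
move=> p r q [U [a [/= pa qax]]] [V [b [/= rb qbx]]].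
have VU : V = U by apply: names_ultra qbx qax _.
rewrite VU in rb qbx; have [Uu Uax] := namesP qax.
apply: eq_from_tnth => i; apply/(names_eq (pa i) (rb i)).
by apply: (comp_sim_inj Uu i Uax); apply/(names_eq qax qbx).
Qed.

Lemma represent_eqv x : entries_equivalent same_ultra (represent x).
Proof.
move=> p q [U [a [/= pa qax]]]; split=> [i j|i].
  exact: names_same (pa i) (pa j).
exact: names_same (pa i) qax.
Qed.

Lemma represent_comp a x :
  represent (comp a x) = rel_comp [tuple represent (a i) | i < n] (represent x).
Proof.
apply/funext => -[p q]; apply/propext; split.
  move=> [U [b [/= pb]]]; rewrite -(law_assoc L) => qbax.
  have [Uu Ubax] := namesP qbax.
  have [r rba] := ex_point_tuple Uu (fun i => comp_in_arg Uu i Ubax).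
  exists r; split; last exact/(representE _ _ rba).
  by move=> i; rewrite tnth_mktuple; apply/(representE _ _ pb).
move=> [r [/= pr rq]]; have [Er _] := represent_eqv rq.
have {}pr i : represent (a i) (p, tnth r i).
  by have := pr i; rewrite tnth_mktuple.
have [Ep _] := represent_eqv (pr i0); have [U [b pb]] := ex_names_tuple Ep.
have rba i := (representE _ _ pb).1 (pr i).
apply/(representE _ _ pb); rewrite -(law_assoc L).
exact/(representE _ _ rba).
Qed.

Lemma represent_anti i x :
  represent (alg_anti i x) = rel_anti same_ultra i (represent x).
Proof.
apply/funext => -[p q]; apply/propext; split.
  move=> [U [a [/= pa qax]]]; have [Uu Uax] := namesP qax.
  have nUax := comp_anti_notin Uu Uax.
  split=> /=.
  - apply/(names_eq qax (pa i)); apply: comp_anti_sim => // j.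
    exact: comp_in_arg Uax.
  - by move=> j k; apply: names_same (pa j) (pa k).
  - by move=> [r /(representE _ _ pa) /namesP []].
move=> [/= -> Ep npx]; have [U [a pa]] := ex_names_tuple Ep.
have [Uu _] := namesP (pa i0).
apply/(representE _ _ pa); apply: names_sim (pa i) _; apply: sim_sym.
apply: comp_anti_sim => // [j|Uax]; first by have [] := namesP (pa j).
apply: npx; have [r rax] := ex_point Uu Uax.
by exists r; apply/(representE _ _ pa).
Qed.

(** At a separating ultrafilter one of the two elements, say [z], is nonzero; it
    sends the germs of the projections to its own germ, so any element acting in
    the same way has that germ as well. *)
Lemma represent_faithful : injective represent.
Proof.
move=> x y xy; apply: contrapT => /ultra_separation [U Uu]; apply.
have sub z t : represent z = represent t -> U z -> sim U z t.
  move=> zt Uz; pose pi i := alg_anti i zero.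
  have Upi u : comp pi u = u by apply: law_proj.
  have Uzpi : U (comp pi z) by rewrite Upi.
  have [p ppi] := ex_point_tuple Uu (fun i => comp_in_arg Uu i Uzpi).
  have [q qz] := ex_point Uu Uzpi.
  have : represent z (p, q) by apply/(representE _ _ ppi).
  rewrite zt => /(representE _ _ ppi) qt.
  by have /(names_eq qz qt) := erefl q; rewrite !Upi.
have [Ux|nUx] := pselect (U x); first exact: sub.
have [Uy|nUy] := pselect (U y); first exact/sim_sym/sub.
apply: (sim_trans Uu (y := zero)); first exact/sim_zeroP.
exact/sim_sym/sim_zeroP.
Qed.

Fact range_nonempty : range represent !=set0.
Proof. by exists (represent o), o. Qed.

Fact range_fun (f : nary_rel n point) : range represent f -> partial_function f.
Proof. by move=> [x _ <-]; apply: represent_fun. Qed.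

Fact range_eqv (f : nary_rel n point) :
  range represent f -> entries_equivalent same_ultra f.
Proof. by move=> [x _ <-]; apply: represent_eqv. Qed.

Fact range_comp (f : n.-tuple (nary_rel n point)) g :
  (forall i, range represent (tnth f i)) -> range represent g ->
  range represent (rel_comp f g).
Proof.
move=> fr [x _ <-].
have /choice [a fa] : forall i, exists y, represent y = tnth f i.
  by move=> i; have [y _ <-] := fr i; exists y.
exists (comp a x) => //; rewrite represent_comp; congr rel_comp.
by apply: eq_from_tnth => i; rewrite tnth_mktuple.
Qed.

Fact range_anti i (f : nary_rel n point) :
  range represent f -> range represent (rel_anti same_ultra i f).
Proof.
by move=> [x _ <-]; exists (alg_anti i x) => //; rewrite represent_anti.
Qed.

Definition representation : pfun_algebra n :=
  PfunAlgebra same_ultraP range_nonempty range_fun range_eqv range_comp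
    range_anti.

Lemma laws_injectively_representable : injectively_representable A.
Proof.
exists representation; split; first by move=> f [x _ <-]; apply: represent_inj.
pose h x : algebra_of_pfuns representation :=
  exist _ (represent x) (imageT represent x).
exists h; split.
- have inv (f : algebra_of_pfuns representation) :
      exists x, represent x = sval f.
    by have [x _ xf] := svalP f; exists x.
  have [g gK] := choice inv; exists g => [x|f].
    exact/represent_faithful/gK.
  by case: f (gK f) => f Rf /= gf; apply: eq_exist.
- move=> a x; apply: eq_exist; rewrite alg_compE represent_comp.
  congr rel_comp; apply: eq_from_tnth => i.
  by rewrite !tnth_mktuple.
- by move=> i x; apply: eq_exist; rewrite represent_anti.
Qed.

End Completeness.

Theorem corollary5p3 (n : nat) (hn : 0 < n) (A : algebra n) :
  List.Forall (satisfies A) (axioms n) <-> injectively_representable A.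
Proof.
rewrite axiomsP; split=> [L|[P [P_inj [h [h_bij h_comp h_anti]]]]].
  have [o] := carrier_nonempty A.
  exact: (laws_injectively_representable hn L o).
have := (axiomsP _).2 (pfun_laws hn P_inj); rewrite -axiomsP.
apply: List.Forall_impl => q.
exact: satisfies_embedding (bij_inj h_bij) h_comp h_anti _ _.
Qed.
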